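(* Let $m\ge 2$, $n\ge 1$ and let $\mathcal{A}\in T_{m,n}$ be a nonnegative tensor (all entries $\ge 0$) that is a Q-tensor. Then for every $\mathbf{q}\in\mathbb{R}^n$ with $\mathbf{q}\ge\mathbf{0}$, $\mathbf{0}$ is the unique solution of the tensor complementarity problem $(\mathbf{q},\mathcal{A})$.
   Context: $T_{m,n}$ is the set of real $m$th order $n$-dimensional tensors $\mathcal{A}=(a_{i_1\cdots i_m})$, with real entries indexed by $i_1,\ldots,i_m\in I_n:=\{1,\ldots,n\}$ (no symmetry assumed). For $\mathbf{x}\in\mathbb{R}^n$, $\mathcal{A}\mathbf{x}^{m-1}\in\mathbb{R}^n$ is the vector with components $(\mathcal{A}\mathbf{x}^{m-1})_i=\sum_{i_2,\ldots,i_m=1}^n a_{ii_2\cdots i_m}x_{i_2}\cdots x_{i_m}$. Vector inequalities are componentwise. Tensor complementarity problem $(\mathbf{q},\mathcal{A})$, for $\mathbf{q}\in\mathbb{R}^n$: find $\mathbf{x}\in\mathbb{R}^n$ such that $\mathbf{x}\ge\mathbf{0}$, $\mathbf{q}+\mathcal{A}\mathbf{x}^{m-1}\ge\mathbf{0}$ and $\mathbf{x}^\top(\mathbf{q}+\mathcal{A}\mathbf{x}^{m-1})=0$. An $\mathbf{x}$ satisfying all three conditions is called a solution. $\mathcal{A}$ is a Q-tensor iff $(\mathbf{q},\mathcal{A})$ has a solution for every $\mathbf{q}\in\mathbb{R}^n$. *)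

(* Defs.v *)
From mathcomp Require Import all_boot all_order all_algebra.
From mathcomp Require Import reals.
Set Implicit Arguments.
Unset Strict Implicit.
Unset Printing Implicit Defensive.
Import Order.TTheory GRing.Theory Num.Theory.
Local Open Scope ring_scope.

Definition tensor (R : realType) (m n : nat) : Type :=
  {ffun m.-tuple 'I_n -> R}.

Definition vec_ge0 (R : realType) (n : nat) (v : 'cV[R]_n) : Prop :=
  forall i : 'I_n, 0 <= v i 0.

Definition nonneg_tensor (R : realType) (m n : nat) (A : tensor R m n) : Prop :=
  forall s : m.-tuple 'I_n, 0 <= A s.

(* Component i sums over the index tuples s = (i, i_2, ..., i_m); the factor
   is the product of the coordinates x_k for k in (i_2, ..., i_m) = behead s.
   Filtering on the head avoids casting (m.-1).+1-tuples to m-tuples; for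
   m = 0 no tuple has a head and the (meaningless) value is 0. *)
Definition tensor_app (R : realType) (m n : nat) (A : tensor R m n)
    (x : 'cV[R]_n) : 'cV[R]_n :=
  \col_(i < n) \sum_(s : m.-tuple 'I_n | ohead s == Some i)
     A s * \prod_(k <- behead s) x k 0.

Definition tcp_solution (R : realType) (m n : nat) (q : 'cV[R]_n)
    (A : tensor R m n) (x : 'cV[R]_n) : Prop :=
  [/\ vec_ge0 x,
      vec_ge0 (q + tensor_app A x)
    & (x^T *m (q + tensor_app A x)) 0 0 = 0].

Definition Q_tensor (R : realType) (m n : nat) (A : tensor R m n) : Prop :=
  forall q : 'cV[R]_n, exists x : 'cV[R]_n, tcp_solution q A x.

(* Main.v *)
(** Testing the Q-property on the vector with entry [-1] at [i] and [1] elsewhere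
    forces its solution to be supported on [i], so [a_{i...i}] must be positive.
    If now [q >= 0] and [x] is a solution with [x_i > 0], then
    [(A x^{m-1})_i >= a_{i...i} x_i^{m-1} > 0] violates complementarity. *)
Require Import Defs.
From mathcomp Require Import all_boot all_order all_algebra.
From mathcomp Require Import reals.
Import Order.TTheory GRing.Theory Num.Theory.
Local Open Scope ring_scope.

Lemma tensor_term_ge0 (R : realType) (m n : nat) (A : tensor R m n)
    (x : 'cV[R]_n) (s : m.-tuple 'I_n) :
  nonneg_tensor A -> vec_ge0 x -> 0 <= A s * \prod_(k <- behead s) x k 0.
Proof. by move=> A0 x0; rewrite mulr_ge0 ?prodr_ge0. Qed.

Lemma tensor_app_ge0 (R : realType) (m n : nat) (A : tensor R m n)
    (x : 'cV[R]_n) :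
  nonneg_tensor A -> vec_ge0 x -> vec_ge0 (tensor_app A x).
Proof.
by move=> A0 x0 i; rewrite mxE sumr_ge0// => s _; apply: tensor_term_ge0.
Qed.

(** The constant tuple [(i, ..., i)] contributes the left side, and all other summands are
    nonnegative. *)
Lemma tensor_app_diag_le (R : realType) (m n : nat) (A : tensor R m n)
    (x : 'cV[R]_n) (i : 'I_n) :
  (0 < m)%N -> nonneg_tensor A -> vec_ge0 x ->
  A (nseq_tuple m i) * x i 0 ^+ m.-1 <= tensor_app A x i 0.
Proof.
case: m A => // m A _ A0 x0; rewrite mxE (bigD1 (nseq_tuple m.+1 i)) //=.
rewrite big_nseq -Monoid.iteropE lerDl sumr_ge0// => s _.
exact: tensor_term_ge0.
Qed.

(** A tuple headed by [i] other than the constant one has some [j != i] in its tail, so its product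
    contains the factor [x j 0 = 0]. *)
Lemma tensor_app_supp1 (R : realType) (m n : nat) (A : tensor R m n)
    (x : 'cV[R]_n) (i : 'I_n) :
  (0 < m)%N -> (forall j, j != i -> x j 0 = 0) ->
  tensor_app A x i 0 = A (nseq_tuple m i) * x i 0 ^+ m.-1.
Proof.
case: m A => // m A _ xi; rewrite mxE (bigD1 (nseq_tuple m.+1 i)) //=.
rewrite big_nseq -Monoid.iteropE big1 ?addr0// => s /andP[/eqP hs sN].
have [/all_pred1P es|/allPn[j js ji]] := boolP (all (pred1 i) (behead s)).
  (* Head and tail all equal to [i] make [s] the constant tuple, which [sN] excludes. *)
  case/eqP: sN; apply: val_inj; case: s hs es => -[|a t] //= /eqP tm [->] ->.
  by case: tm => ->.
by rewrite (big_rem j js)/= xi// mul0r mulr0.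
Qed.

(** A vanishing inner product of two nonnegative vectors vanishes term by term. *)
Lemma tcp_solution_compl (R : realType) (m n : nat) (A : tensor R m n)
    (q x : 'cV[R]_n) (i : 'I_n) :
  tcp_solution q A x -> x i 0 * (q i 0 + tensor_app A x i 0) = 0.
Proof.
case=> x0 w0; rewrite mxE => /psumr_eq0P sum0.
have := sum0 _ i isT; rewrite !mxE; apply=> j _.
by rewrite mxE mulr_ge0.
Qed.

Lemma nonneg_Q_tensor_diag_gt0 (R : realType) (m n : nat) (A : tensor R m n)
    (i : 'I_n) :
  (0 < m)%N -> nonneg_tensor A -> Q_tensor A -> 0 < A (nseq_tuple m i).
Proof.
move=> m0 A0 AQ; rewrite lt0r A0 andbT; apply/eqP => Ai0.
have [x xs] := AQ (\col_j (if j == i then -1 else 1)).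
have [x0 w0 _] := xs.
have xi j : j != i -> x j 0 = 0.
  move=> /negPf ji; have /eqP := tcp_solution_compl _ _ _ _ _ _ j xs.
  rewrite mxE ji mulf_eq0 => /orP[/eqP//|].
  (* The second factor is 1 plus a nonnegative number, so it cannot be the one that vanishes. *)
  by rewrite gt_eqF// ltr_wpDr ?tensor_app_ge0.
(* With [Ai0], feasibility in component [i] reduces to [0 <= -1]. *)
have := w0 i; rewrite mxE (tensor_app_supp1 _ _ _ _ _ _ m0 xi) Ai0 mul0r addr0.
by rewrite mxE eqxx oppr_ge0 ler10.
Qed.

Theorem corollary3p7 (R : realType) (m n : nat) (hm : (2 <= m)%N)
    (hn : (1 <= n)%N) (A : tensor R m n) (hA : nonneg_tensor A)
    (hQ : Q_tensor A) (q : 'cV[R]_n) (hq : vec_ge0 q) :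
  unique (tcp_solution q A) 0.
Proof.
have m0 : (0 < m)%N by apply: ltnW.
split=> [|x xs].
  have z0 : vec_ge0 (0 : 'cV[R]_n) by move=> i; rewrite mxE.
  split=> // [i|]; last by rewrite trmx0 mul0mx mxE.
  by rewrite mxE addr_ge0 ?tensor_app_ge0.
have [x0 _ _] := xs.
apply/matrixP => i j; rewrite ord1 mxE; apply/esym/eqP.
have /eqP := tcp_solution_compl _ _ _ _ _ _ i xs.
rewrite mulf_eq0 => /orP[//|]; apply: contraLR => xi.
have xi_gt0 : 0 < x i 0 by rewrite lt0r xi x0.
(* As [q i 0] is nonnegative, a positive diagonal term suffices to keep the second factor from
   vanishing. *)
rewrite gt_eqF// ltr_wpDl//.
apply: lt_le_trans (tensor_app_diag_le _ _ _ _ _ i m0 hA x0).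
by rewrite mulr_gt0 ?exprn_gt0 ?nonneg_Q_tensor_diag_gt0.
Qed.
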